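(* For any integer $k\ge0$, each of the $k$th degree falling factorial basis functions $h^k_1,\ldots,h^k_n$ has matching $k$th discrete derivative and $k$th derivative at all $x>x_k$; hence, by linearity, every $f\in\mathcal{H}^k_n=\mathrm{span}\{h^k_1,\ldots,h^k_n\}$ (that is, every $k$th degree discrete spline with knots in $x_{(k+1):(n-1)}$) satisfies $$(\Delta^k_nf)(x)=(D^kf)(x)\quad\text{for all }x\in(x_k,b].\qquad( * )$$ Conversely, if $f$ is a $k$th degree piecewise polynomial on $[a,b]$ with knots in $x_{(k+1):(n-1)}=\{x_{k+1},\ldots,x_{n-1}\}$ and $f$ satisfies $( * )$, then $f\in\mathcal{H}^k_n$.
   Context: Design points: $a\le x_1<\cdots<x_n\le b$ with $n\ge k+1$, and $x_{n+1}=b$. When $k=0$, the range $(x_k,b]$ is read as $[a,b]$. Empty products equal 1. Divided differences: $f[z]=f(z)$ and $f[z_1,\ldots,z_{r+1}]=(f[z_2,\ldots,z_{r+1}]-f[z_1,\ldots,z_r])/(z_{r+1}-z_1)$ for distinct points. Discrete derivatives: $\Delta^0_n=\mathrm{Id}$ and, for $k\ge1$, $(\Delta^k_nf)(x)=k!\,f[x_{i-k+1},\ldots,x_i,x]$ if $x\in(x_i,x_{i+1}]$, $i\ge k$; $(\Delta^k_nf)(x)=i!\,f[x_1,\ldots,x_i,x]$ if $x\in(x_i,x_{i+1}]$, $1\le i<k$; $(\Delta^k_nf)(x)=f(x)$ if $x\le x_1$. Falling factorial basis: $h^k_j(x)=\frac1{(j-1)!}\prod_{\ell=1}^{j-1}(x-x_\ell)$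 for $j=1,\ldots,k+1$, and $h^k_j(x)=\frac1{k!}\prod_{\ell=j-k}^{j-1}(x-x_\ell)\cdot1\{x>x_{j-1}\}$ for $j=k+2,\ldots,n$. $D^k$ is the $k$-fold derivative, where each derivative is read as the left derivative when the derivative does not exist. A $k$th degree piecewise polynomial with knots in $\{x_{k+1},\ldots,x_{n-1}\}$ is a function on $[a,b]$ that agrees with a polynomial of degree at most $k$ on each of the segments $[a,x_{k+1}]$, $(x_{k+1},x_{k+2}]$, ..., $(x_{n-2},x_{n-1}]$, $(x_{n-1},b]$ (a single segment $[a,b]$ if there are no knots). *)

(* Defs.v *)
From HB Require Import structures.
From mathcomp Require Import all_boot all_order all_algebra.
From mathcomp Require Import all_classical all_reals all_analysis.

Set Implicit Arguments.
Unset Strict Implicit.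
Unset Printing Implicit Defensive.

Import Order.TTheory GRing.Theory Num.Theory.
Import numFieldNormedType.Exports.

Local Open Scope classical_set_scope.
Local Open Scope ring_scope.

(* Conventions.  The design points are x 1 < ... < x n, with 1-based indices   *)
(* in a sequence x : nat -> R; x n.+1 is b, and no other value of x is used.   *)
(* A function on [a, b] is represented by a total f : R -> R; nothing below    *)
(* depends on its values outside [a, b] at the points where it is evaluated in *)
(* the theorem (see lderivative).                                              *)

(* divdiff_rec f z m r = f[z_m, ..., z_(m + r)] *)
Fixpoint divdiff_rec {R : realType} (f : R -> R) (z : nat -> R) (m r : nat) : R :=
  if r is r'.+1 then
    (divdiff_rec f z m.+1 r' - divdiff_rec f z m r') / (z (m + r)%N - z m)
  else f (z m).

(* f[s], for a nonempty list s of distinct points *)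
Definition divdiff {R : realType} (f : R -> R) (s : seq R) : R :=
  divdiff_rec f (nth 0 s) 0 (size s).-1.

(* For a <= t <= b, the index i with x i < t <= x i.+1 is unique if it exists, *)
(* and there is none exactly when t <= x 1.                                    *)
Definition discrete_deriv {R : realType} (n : nat) (x : nat -> R) (k : nat)
    (f : R -> R) (t : R) : R :=
  if k == 0%N then f t else
  match [pick i : 'I_n.+1 | (0 < i)%N && (x i < t <= x i.+1)] with
  | Some i =>
      if (k <= i)%N then
        k`!%:R * divdiff f (rcons [seq x l | l <- index_iota (i - k + 1)%N i.+1] t)
      else
        i`!%:R * divdiff f (rcons [seq x l | l <- index_iota 1 i.+1] t)
  | None => f t
  end.

Definition falling_basis {R : realType} (x : nat -> R) (k j : nat) (t : R) : R :=
  if (j <= k.+1)%N then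
    ((j.-1)`!%:R)^-1 * \prod_(1 <= l < j) (t - x l)
  else
    (k`!%:R)^-1 * \prod_(j - k <= l < j) (t - x l) * (x j.-1 < t)%R%:R.

Definition in_falling_span {R : realType} (a b : R) (n : nat) (x : nat -> R)
    (k : nat) (f : R -> R) : Prop :=
  exists c : nat -> R,
    {in `[a, b], forall t,
      f t = \sum_(1 <= j < n.+1) c j * falling_basis x k j t}.

Definition left_quotient {R : realType} (f : R -> R) (t h : R) : R :=
  h^-1 *: (f (h + t) - f t).

Definition left_derivable {R : realType} (f : R -> R) (t : R) : Prop :=
  cvg (left_quotient f t h @[h --> 0^'-]).

(* A two-sided derivative, when it exists, equals the left derivative, so this *)
(* only involves f on some ]t - e, t] (in particular at t = b), and it is      *)
(* meaningful exactly when f is left_derivable at t.                           *)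
Definition lderivative {R : realType} (f : R -> R) (t : R) : R :=
  if `[< derivable f t 1 >] then derive1 f t
  else lim (left_quotient f t h @[h --> 0^'-]).

Definition lderivative_n {R : realType} (k : nat) (f : R -> R) : R -> R :=
  iter k lderivative f.

(* ]x k, b], read as [a, b] for k = 0 *)
Definition match_range {R : realType} (a b : R) (x : nat -> R) (k : nat) :
    interval R :=
  if k == 0%N then `[a, b] else `]x k, b].

(* All k successive derivatives exist on match_range (which, for k > 0, is a   *)
(* left neighbourhood of each of its points), so that lderivative_n k f is not *)
(* a default value of lim there.                                               *)
Definition has_lderivative_n {R : realType} (a b : R) (x : nat -> R) (k : nat)
    (f : R -> R) : Prop :=
  forall m, (m < k)%N ->
    {in match_range a b x k, forall t, left_derivable (lderivative_n m f) t}.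

Definition matching_derivatives {R : realType} (a b : R) (n : nat)
    (x : nat -> R) (k : nat) (f : R -> R) : Prop :=
  {in match_range a b x k, forall t,
    discrete_deriv n x k f t = lderivative_n k f t}.

(* The segments are indexed by k <= i < n: segment k starts at a (included),   *)
(* segment n.-1 ends at b, and segment i is ]x i, x i.+1] otherwise; for       *)
(* n = k.+1 this leaves the single segment [a, b].                             *)
Definition segment {R : realType} (a b : R) (n : nat) (x : nat -> R)
    (k i : nat) : interval R :=
  Interval (if i == k then BLeft a else BRight (x i))
           (BRight (if i.+1 == n then b else x i.+1)).

Definition piecewise_poly {R : realType} (a b : R) (n : nat) (x : nat -> R)
    (k : nat) (f : R -> R) : Prop :=
  forall i, (k <= i < n)%N ->
    exists p : {poly R}, (size p <= k.+1)%N /\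
      {in segment a b n x k i, forall t, f t = p.[t]}.

(* Main.v *)
Require Import Defs.
From HB Require Import structures.
From mathcomp Require Import all_boot all_order all_algebra.
From mathcomp Require Import all_classical all_reals all_analysis.
From mathcomp Require Import ring lra zify.

Import Order.TTheory GRing.Theory Num.Theory.
Import numFieldNormedType.Exports.

Local Open Scope ring_scope.

(** The divided difference of [f] at [k + 1] points is the coefficient of
    degree [k] of the polynomial of degree at most [k] that interpolates [f]
    there ([divdiff_interp]).  On the other side, the [k]-th left derivative of a
    polynomial of degree at most [k] is [k!] times the same coefficient
    ([lderivative_n_top]).  So if [f] coincides on (x_i, x_{i+1}] with a
    polynomial [p] of degree at most [k], then [f] has matching derivatives on
    this interval as soon as [p] continues to agree with [f] at the [k] design
    points [x_{i-k+1}, ..., x_i] to its left.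

    Falling factorial functions have this property.  A truncated [h_j] vanishes
    at every design point up to [x_{j-1}], and its polynomial part also vanishes
    at the last [k] of these; so dropping the truncation changes nothing at the
    [k] points to the left of an interval on which [h_j] is active
    ([falling_sum_knot]).

    The property is also necessary ([divdiff_const_interp]).  Let [L]
    interpolate [f] at the [k] points to the left.  Newton's formula
    [f t = L(t) + f[x_{i-k+1}, ..., x_i, t] * prod (t - x_l)], with a divided
    difference which by matching is the coefficient of degree [k] of [p],
    identifies [p] with [L] plus a multiple of the product.

    Hence two adjacent pieces of a piecewise polynomial with matching
    derivatives agree at the [k] design points up to their common knot, and
    their difference is a multiple of the polynomial part of the basis function
    which starts at that knot.  The first piece being a combination of the
    untruncated basis functions by Newton's expansion, all the pieces are
    combinations with common coefficients ([basis_piece_expansion]). *)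

(** * Divided differences and interpolation *)

Lemma size_sub_lead {F : fieldType} (P Q : {poly F}) (n : nat) :
  (size P <= n.+1)%N -> Q \is monic -> size Q = n.+1 ->
  (size (P - P`_n *: Q)%R <= n)%N.
Proof.
move=> sP monQ sQ; apply/leq_sizeP => i; rewrite leq_eqVlt => /predU1P[<-|lt_ni].
  rewrite coefB coefZ; move/monicP: monQ; rewrite lead_coefE sQ /= => ->.
  by rewrite mulr1 subrr.
have Pi : P`_i = 0 by rewrite nth_default // (leq_trans sP).
have Qi : Q`_i = 0 by rewrite nth_default ?sQ.
by rewrite coefB coefZ Pi Qi mulr0 subrr.
Qed.

(** From the interpolant [P] at [r + 2] points, subtracting a multiple of the
    product of [r + 1] of the linear factors lowers the degree without touching
    the values at these points.  Omitting the last or the first point gives the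
    two interpolants whose top coefficients appear in the recursion, and their
    difference is explicit. *)
Lemma divdiff_rec_interp {R : realType} {f : R -> R} {z : nat -> R} {m r : nat}
    {P : {poly R}} :
  {in [pred i | m <= i <= m + r]%N &, injective z} ->
  (size P <= r.+1)%N ->
  {in [pred i | m <= i <= m + r]%N, forall i, P.[z i] = f (z i)} ->
  divdiff_rec f z m r = P`_r.
Proof.
elim: r m P => [|r IH] m P inj_z sP Pz /=.
  rewrite -Pz ?inE ?addn0 ?leqnn //.
  by rewrite (size1_polyC sP) hornerC coefC.
pose mid : {poly R} := \prod_(i <- index_iota m.+1 (m + r.+1)) ('X - (z i)%:P).
have mid_monic : mid \is monic by exact: monic_prod_XsubC.
have size_mid : size mid = r.+1.
  by rewrite size_prod_XsubC size_iota; lia.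
have mid_root : forall i, (m < i <= m + r)%N -> mid.[z i] = 0.
  move=> i hi; have ii : i \in index_iota m.+1 (m + r.+1) by rewrite mem_index_iota; lia.
  by rewrite /mid (bigD1_seq i) ?iota_uniq //= hornerM hornerXsubC subrr mul0r.
(* For [a] one end of the range, [low a] loses the interpolation property at
   the opposite end only. *)
pose low a := P - P`_r.+1 *: (mid * ('X - a%:P)).
have size_low a : (size (low a) <= r.+1)%N.
  apply: size_sub_lead => //; first by rewrite monicMl // monicXsubC.
  by rewrite size_Mmonic ?polyXsubC_eq0 ?monicXsubC ?monic_neq0 // size_XsubC size_mid; lia.
have low_interp : forall a j, (m <= j <= m + r.+1)%N ->
    (m < j <= m + r)%N \/ z j = a -> (low a).[z j] = f (z j).
  move=> a j hj hja; rewrite hornerD hornerN hornerZ hornerM hornerXsubC Pz //.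
  by case: hja => [/mid_root->|->]; rewrite ?subrr ?(mul0r, mulr0) subr0.
rewrite (IH m.+1 (low (z (m + r.+1)%N))) ?size_low //; first last.
- move=> i /=; rewrite inE => hi; apply: low_interp; first by lia.
  have [->|] := eqVneq i (m + r.+1)%N; [by right|by left; lia].
- by move=> i j /= hi hj; apply: inj_z; rewrite !inE in hi hj *; lia.
rewrite (IH m (low (z m))) ?size_low //; first last.
- move=> i /=; rewrite inE => hi; apply: low_interp; first by lia.
  have [->|] := eqVneq i m; [by right|by left; lia].
- by move=> i j /= hi hj; apply: inj_z; rewrite !inE in hi hj *; lia.
have zz : z (m + r.+1)%N - z m != 0.
  rewrite subr_eq0; apply/eqP => /inj_z e.
  by have : (m + r.+1)%N = m; [apply: e; rewrite inE|]; lia.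
apply: (canLR (mulfK zz)).
rewrite -coefB.
have -> : low (z (m + r.+1)%N) - low (z m) =
    (P`_r.+1 * (z (m + r.+1)%N - z m)) *: mid.
  by rewrite /low -!mul_polyC polyCM polyCB; ring.
have mid1 : mid`_r = 1 by move/monicP: mid_monic; rewrite lead_coefE size_mid.
by rewrite coefZ mid1 mulr1.
Qed.

Lemma divdiff_interp {R : realType} (f : R -> R) (s : seq R) (P : {poly R}) :
  uniq s -> s != [::] -> (size P <= size s)%N ->
  {in s, forall y, P.[y] = f y} ->
  divdiff f s = P`_(size s).-1.
Proof.
move=> us s0 sP Ps; rewrite /divdiff.
have ss : (0 < size s)%N by rewrite lt0n size_eq0.
have lt_s : forall i, (i <= (size s).-1)%N = (i < size s)%N.
  by move=> i; rewrite -ltnS prednK.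
apply: divdiff_rec_interp; rewrite ?prednK //.
  move=> i j /=; rewrite !inE add0n => hi hj /eqP.
  by rewrite nth_uniq -?lt_s //; move/eqP.
by move=> i; rewrite inE /= add0n lt_s => hi; exact/Ps/mem_nth.
Qed.

(** Newton's formula: the multiple of the node polynomial that corrects [L] at
    the new point [t] is the top coefficient of the enlarged interpolant. *)
Lemma divdiff_rcons {R : realType} (f : R -> R) (s : seq R) (t : R) (L : {poly R}) :
  uniq (rcons s t) -> (size L <= size s)%N ->
  {in s, forall y, L.[y] = f y} ->
  f t = (L + divdiff f (rcons s t) *: \prod_(y <- s) ('X - y%:P)).[t].
Proof.
rewrite rcons_uniq => /andP[ts us] sL Ls.
set N := \prod_(y <- s) _.
have Nt : N.[t] != 0 by rewrite -rootE root_prod_XsubC.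
have sN : size N = (size s).+1 by rewrite size_prod_XsubC.
pose c := (f t - L.[t]) / N.[t].
have e : f t = (L + c *: N).[t] by rewrite hornerD hornerZ divfK // addrC subrK.
rewrite (@divdiff_interp _ _ _ (L + c *: N)) ?rcons_uniq ?ts ?size_rcons //=.
- rewrite coefD nth_default // add0r coefZ.
  have : N \is monic by exact: monic_prod_XsubC.
  by move/monicP; rewrite lead_coefE sN /= => ->; rewrite mulr1.
- by case: (s).
- rewrite (leq_trans (size_polyD _ _)) // geq_max (leq_trans sL) //=.
  by rewrite (leq_trans (size_scale_leq _ _)) // sN.
- move=> y; rewrite mem_rcons inE => /predU1P[->//|ys].
  rewrite hornerD hornerZ Ls //.
  by have /rootP-> : root N y; rewrite ?root_prod_XsubC // mulr0 addr0.
Qed.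

Lemma ex_interpolant {R : realType} (f : R -> R) (s : seq R) : uniq s ->
  exists L : {poly R}, (size L <= size s)%N /\ {in s, forall y, L.[y] = f y}.
Proof.
elim/last_ind: s => [_|s t IH us]; first by exists 0; rewrite size_poly0.
have [|L [sL Ls]] := IH; first by move: us; rewrite rcons_uniq => /andP[].
exists (L + divdiff f (rcons s t) *: \prod_(y <- s) ('X - y%:P)); split.
  rewrite size_rcons (leq_trans (size_polyD _ _)) // geq_max (leq_trans sL) //=.
  by rewrite (leq_trans (size_scale_leq _ _)) // size_prod_XsubC.
move=> y; rewrite mem_rcons inE => /predU1P[->|ys].
  by rewrite -(divdiff_rcons _ _ _ _ us sL Ls).
rewrite hornerD hornerZ Ls //.
by have /rootP-> : root (\prod_(y <- s) ('X - y%:P)) y;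
   rewrite ?root_prod_XsubC // mulr0 addr0.
Qed.

(** An interval contains more points than the degree of [p]; the roots used are
    [u + (v - u) / (m + 1)]. *)
Lemma poly_eq0_itv {R : realType} (p : {poly R}) (u v : R) : u < v ->
  {in `]u, v], forall t, p.[t] = 0} -> p = 0.
Proof.
move=> uv p0.
pose g m : R := u + (v - u) / m.+1%:R.
apply: (@roots_geq_poly_eq0 _ p (mkseq g (size p))); last by rewrite size_mkseq.
- apply/allP => _ /mapP[m _ ->]; apply/rootP/p0.
  rewrite in_itv /= /g ltrDl divr_gt0 ?subr_gt0 ?ltr0n //=.
  rewrite -lerBrDl ler_pdivrMr ?ltr0n //.
  by apply: ler_peMr; [rewrite subr_ge0 ltW|rewrite ler1n].
- apply: mkseq_uniq => i j /addrI/mulfI; rewrite subr_eq0 => /(_ (negbT (gt_eqF uv))).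
  by move/invr_inj/eqP; rewrite eqr_nat => /eqP[].
Qed.

Lemma vanish_prodE {F : fieldType} (q : {poly F}) (s : seq F) :
  uniq s -> (size q <= (size s).+1)%N -> {in s, forall y, q.[y] = 0} ->
  q = q`_(size s) *: \prod_(y <- s) ('X - y%:P).
Proof.
move=> us sq q0; apply/eqP; rewrite -subr_eq0; apply/eqP.
apply: (@roots_geq_poly_eq0 _ _ s) => //; last first.
  by apply: size_sub_lead; rewrite ?monic_prod_XsubC ?size_prod_XsubC.
apply/allP => y ys; apply/rootP; rewrite hornerD hornerN hornerZ q0 //.
have /rootP-> : root (\prod_(y <- s) ('X - y%:P)) y by rewrite root_prod_XsubC.
by rewrite mulr0 subr0.
Qed.

(** By Newton's formula [p] coincides on the interval with [L] plus a multiple of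
    the node polynomial, where [L] interpolates [f] at [s]; so they are the same
    polynomial, and the node polynomial vanishes on [s]. *)
Lemma divdiff_const_interp {R : realType} (f : R -> R) (s : seq R)
    (p : {poly R}) (u v : R) : u < v ->
  uniq s -> {in s, forall y, y <= u} ->
  {in `]u, v], f =1 horner p} ->
  {in `]u, v], forall t, divdiff f (rcons s t) = p`_(size s)} ->
  {in s, forall y, p.[y] = f y}.
Proof.
move=> uv us su fp dd.
have [L [sL Ls]] := ex_interpolant f s us.
have -> : p = L + p`_(size s) *: \prod_(y <- s) ('X - y%:P).
  apply/eqP; rewrite -subr_eq0; apply/eqP; apply: (poly_eq0_itv _ u v uv) => t tuv.
  have ts : uniq (rcons s t).
    rewrite rcons_uniq us andbT; apply/negP => /su; apply/negP; rewrite -ltNge.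
    by move: tuv; rewrite in_itv /= => /andP[].
  by rewrite hornerD hornerN -(dd t tuv) -(divdiff_rcons _ _ _ _ ts sL Ls) fp // subrr.
move=> y ys; rewrite hornerD hornerZ Ls //.
have /rootP-> : root (\prod_(y <- s) ('X - y%:P)) y by rewrite root_prod_XsubC.
by rewrite mulr0 addr0.
Qed.

(** * Left derivatives of functions that are polynomial on an interval *)

(** When the two-sided derivative exists, its difference quotient also converges
    along the left punctured neighbourhoods, so both branches of the definition
    are the left limit. *)
Lemma lderivativeE {R : realType} (f : R -> R) (t d : R) :
  (left_quotient f t h @[h --> 0^'-] --> d)%classic -> lderivative f t = d.
Proof.
move=> fd; rewrite /lderivative; case: asboolP => [df|_]; last exact: cvg_lim fd.
have /cvg_ex[l fl] : cvg (left_quotient f t h @[h --> 0^'])%classic.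
  move: df; rewrite /derivable /left_quotient.
  by under eq_fun do rewrite /= scaler1.
rewrite /derive1 (cvg_lim _ fl) //.
exact: (cvg_unique _ (cvg_dnbhs_at_left fl) fd).
Qed.

Lemma left_quotient_poly {R : realType} (f : R -> R) (p : {poly R}) (u t : R) :
  u < t -> {in `]u, t], f =1 horner p} ->
  (left_quotient f t h @[h --> 0^'-] --> p^`().[t])%classic.
Proof.
move=> ut fp.
have dp : (left_quotient (horner p) t h @[h --> 0^'-] --> p^`().[t])%classic.
  apply: cvg_dnbhs_at_left; rewrite derivE /derive1.
  have := @derivable_horner _ p t; rewrite /derivable /left_quotient.
  by under eq_fun do rewrite /= scaler1.
apply: cvg_trans dp; apply: near_eq_cvg.
near=> h; rewrite /left_quotient !fp //= in_itv /= ?ut ?lexx //.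
have h0 : h < 0 by near: h; exact: nbhs_left_lt.
have hu : u - t < h by near: h; apply: nbhs_left_gt; rewrite subr_lt0.
by apply/andP; split; lra.
Unshelve. all: by end_near. Qed.

(** Half-open intervals closed on the right contain a left neighbourhood of each
    of their points, so that the identity can be iterated. *)
Lemma lderivative_n_poly {R : realType} (f : R -> R) (p : {poly R}) (u v : R) m :
  {in `]u, v], f =1 horner p} ->
  {in `]u, v], lderivative_n m f =1 horner p^`(m)}.
Proof.
move=> fp; elim: m => [//|m IH] t tuv.
rewrite derivnS /lderivative_n iterS; apply: lderivativeE.
have /andP[ut tv] : u < t <= v by rewrite in_itv in tuv.
apply: left_quotient_poly ut _ => w wut; apply: IH.
by move: wut; rewrite !in_itv /= => /andP[-> /le_trans->].
Qed.

Lemma lderivative_n_top {R : realType} (f : R -> R) (p : {poly R}) (u v : R) k :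
  (size p <= k.+1)%N -> {in `]u, v], f =1 horner p} ->
  {in `]u, v], forall t, lderivative_n k f t = k`!%:R * p`_k}.
Proof.
move=> sp fp t tuv; rewrite (lderivative_n_poly _ _ _ _ k fp) //.
have -> : p^`(k) = (k`!%:R * p`_k)%:P; last by rewrite hornerC.
apply/polyP => i; rewrite coef_derivn coefC.
case: i => [|i]; first by rewrite addn0 ffactnn mulr_natl.
by rewrite nth_default ?mul0rn // (leq_trans sp) // addnS ltnS leq_addr.
Qed.

(** * Design points *)

Definition knots {R : realType} (x : nat -> R) (p q : nat) : seq R :=
  [seq x l | l <- index_iota p q].

Lemma knots_homo {R : realType} (x : nat -> R) (n : nat) :
  (forall i : nat, (1 <= i)%N -> (i < n)%N -> x i < x i.+1) ->
  forall i j, (1 <= i)%N -> (i < j <= n)%N -> x i < x j.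
Proof.
move=> hx i j hi; elim: j => [//|j IH] /andP[]; rewrite ltnS leq_eqVlt.
move=> /predU1P[<-|ij] jn; first exact: hx.
by apply: (lt_trans (IH _)); [lia|apply: hx; lia].
Qed.

Lemma knots_homo_le {R : realType} (x : nat -> R) (n : nat) :
  (forall i : nat, (1 <= i)%N -> (i < n)%N -> x i < x i.+1) ->
  forall i j, (1 <= i)%N -> (i <= j <= n)%N -> x i <= x j.
Proof.
move=> hx i j hi; rewrite leq_eqVlt => /andP[/predU1P[->//|ij] jn].
by apply/ltW/(knots_homo _ _ hx); rewrite ?ij.
Qed.

Lemma knots_uniq {R : realType} (x : nat -> R) (n p q : nat) :
  (forall i : nat, (1 <= i)%N -> (i < n)%N -> x i < x i.+1) ->
  (1 <= p)%N -> (q <= n.+1)%N -> uniq (knots x p q).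
Proof.
move=> hx hp hq; rewrite map_inj_in_uniq ?iota_uniq // => i j.
rewrite !mem_index_iota => hi hj e; apply/eqP; case: ltngtP => // ij.
- by have := knots_homo _ _ hx i j; rewrite e ltxx; lia.
- by have := knots_homo _ _ hx j i; rewrite e ltxx; lia.
Qed.

Lemma ex_knot_itv {R : realType} (x : nat -> R) (k m : nat) (t : R) :
  x k < t <= x m -> (k <= m)%N ->
  exists i, (k <= i < m)%N /\ x i < t <= x i.+1.
Proof.
move=> /andP[kt]; elim: m => [tm|m IH tm].
  by rewrite leqn0 => /eqP k0; move: kt; rewrite k0 ltNge tm.
rewrite leq_eqVlt => /predU1P[k0|km]; first by move: kt; rewrite k0 ltNge tm.
have [tm'|mt] := leP t (x m); last by exists m; rewrite mt tm; split => //; lia.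
by have [i [hi hit]] := IH tm' km; exists i; split => //; lia.
Qed.

(** The index selected by the definition is unique because the design points
    increase. *)
Lemma discrete_derivE {R : realType} (x : nat -> R) (n k i : nat) (f : R -> R) (t : R) :
  (forall i : nat, (1 <= i)%N -> (i < n)%N -> x i < x i.+1) ->
  (0 < k <= i)%N -> (i <= n)%N -> x i < t <= x i.+1 ->
  discrete_deriv n x k f t = k`!%:R * divdiff f (rcons (knots x (i.+1 - k) i.+1) t).
Proof.
move=> hx /andP[k0 ki] hin /andP[it ti]; rewrite /discrete_deriv eqn0Ngt k0 /=.
case: pickP => [j /andP[j0 /andP[jt tj]]|/(_ (Ordinal (hin : (i < n.+1)%N)))]; last first.
  by rewrite /= it ti andbT; lia.
have jn : (j <= n)%N by rewrite -ltnS.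
have -> : nat_of_ord j = i.
  apply/eqP; case: ltngtP => // ij.
  - have := knots_homo_le _ _ hx j.+1 i isT; rewrite ij hin => /(_ isT) /(le_trans tj).
    by rewrite leNgt it.
  - have := knots_homo_le _ _ hx i.+1 j isT; rewrite ij jn => /(_ isT) /(le_trans ti).
    by rewrite leNgt jt.
by rewrite ki addn1 subSn.
Qed.

(** * Falling factorial functions as truncated polynomials *)

(** The polynomial part of the falling factorial function of index [j >= 1]; the
    minimum and the maximum merge the untruncated ([j <= k + 1]) and the
    truncated cases. *)
Definition basis_poly {R : realType} (x : nat -> R) (k j : nat) : {poly R} :=
  ((minn j.-1 k)`!%:R)^-1 *: \prod_(y <- knots x (maxn 1 (j - k)) j) ('X - y%:P).

Lemma size_basis_poly {R : realType} (x : nat -> R) (k j : nat) :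
  (size (basis_poly x k j) <= k.+1)%N.
Proof.
rewrite (leq_trans (size_scale_leq _ _)) // size_prod_XsubC size_map size_iota.
by lia.
Qed.

Lemma root_basis_poly {R : realType} (x : nat -> R) (k j l : nat) :
  (0 < l)%N -> (j - k <= l < j)%N -> (basis_poly x k j).[x l] = 0.
Proof.
move=> l0 hl; rewrite hornerZ.
have /rootP-> : root (\prod_(y <- knots x (maxn 1 (j - k)) j) ('X - y%:P)) (x l).
  by rewrite root_prod_XsubC; apply: map_f; rewrite mem_index_iota; lia.
by rewrite mulr0.
Qed.

Lemma falling_basis_active {R : realType} (x : nat -> R) (k j : nat) (t : R) :
  (1 <= j)%N -> (j <= k.+1)%N \/ x j.-1 < t ->
  falling_basis x k j t = (basis_poly x k j).[t].
Proof.
move=> j1 act; rewrite /falling_basis /basis_poly /knots big_map hornerZ horner_prod.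
under [in RHS]eq_bigr do rewrite hornerXsubC.
case: leqP => jk.
  have -> : maxn 1 (j - k) = 1%N by lia.
  by have -> : minn j.-1 k = j.-1 by lia.
have -> : maxn 1 (j - k) = (j - k)%N by lia.
have -> : minn j.-1 k = k by lia.
by case: act => [|->]; [lia|rewrite mulr1].
Qed.

Lemma falling_basis_inactive {R : realType} (x : nat -> R) (k j : nat) (t : R) :
  (k.+1 < j)%N -> t <= x j.-1 -> falling_basis x k j t = 0.
Proof.
by move=> kj tj; rewrite /falling_basis leqNgt kj /= ltNge tj mulr0.
Qed.

Definition basis_piece {R : realType} (x : nat -> R) (k : nat) (c : nat -> R)
    (m : nat) : {poly R} :=
  \sum_(1 <= j < m.+1) c j *: basis_poly x k j.

Lemma size_basis_piece {R : realType} (x : nat -> R) (k : nat) (c : nat -> R) (m : nat) :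
  (size (basis_piece x k c m) <= k.+1)%N.
Proof.
rewrite (leq_trans (size_sum _ _ _)) //; apply/bigmax_leqP_seq => j _ _.
by rewrite (leq_trans (size_scale_leq _ _)) ?size_basis_poly.
Qed.

(** If at [t] the first [m] functions take the value of their polynomial part
    and the others are still zero, the truncations disappear from the sum. *)
Lemma falling_sumE {R : realType} (x : nat -> R) (k n m : nat) (c : nat -> R) (t : R) :
  (k < m <= n)%N ->
  (forall j, (k.+1 < j <= m)%N -> falling_basis x k j t = (basis_poly x k j).[t]) ->
  (forall j, (m < j <= n)%N -> t <= x j.-1) ->
  \sum_(1 <= j < n.+1) c j * falling_basis x k j t = (basis_piece x k c m).[t].
Proof.
move=> hm act inact; rewrite (@big_cat_nat _ _ _ m.+1) /=; [|by lia..].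
rewrite [X in _ + X]big_nat [X in _ + X]big1 ?addr0; last first.
  by move=> j hj; rewrite falling_basis_inactive ?mulr0 //; [lia|apply: inact; lia].
rewrite horner_sum; apply: eq_big_nat => j hj; rewrite hornerZ; congr (_ * _).
have [jk|jk] := leqP j k.+1; first by apply: falling_basis_active; [lia|left].
by apply: act; lia.
Qed.

Lemma falling_sum_itv {R : realType} (x : nat -> R) (k n i : nat) (c : nat -> R) (t : R) :
  (forall i : nat, (1 <= i)%N -> (i < n)%N -> x i < x i.+1) ->
  (k < n)%N -> (k <= i <= n)%N -> ((k < i)%N -> x i < t) -> ((i.+1 < n)%N -> t <= x i.+1) ->
  \sum_(1 <= j < n.+1) c j * falling_basis x k j t =
  (basis_piece x k c (minn i.+1 n)).[t].
Proof.
move=> hx kn ki it ti; apply: falling_sumE => [|j hj|j hj]; first by lia.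
  apply: falling_basis_active; [lia|right].
  apply: le_lt_trans (it _); last by lia.
  have [->//|ij] := eqVneq j.-1 i.
  by apply: (knots_homo_le _ n hx); lia.
by apply: (le_trans (ti _)); [lia|apply: (knots_homo_le _ n hx); lia].
Qed.

(** The polynomial that represents the sum on the interval after [x_i] is also
    correct at the [k] design points up to [x_i].  If [x_l] precedes the start
    [x_{j-1}] of [h_j], it is one of the last [k] points up to [x_{j-1}], where
    both [h_j] and its polynomial part vanish. *)
Lemma falling_sum_knot {R : realType} (x : nat -> R) (k n i l : nat) (c : nat -> R) :
  (forall i : nat, (1 <= i)%N -> (i < n)%N -> x i < x i.+1) ->
  (k < n)%N -> (k <= i <= n)%N -> (i.+1 - k <= l <= i)%N ->
  \sum_(1 <= j < n.+1) c j * falling_basis x k j (x l) =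
  (basis_piece x k c (minn i.+1 n)).[x l].
Proof.
move=> hx kn hi hl; apply: falling_sumE => [|j hj|j hj]; first by lia.
  have [jl|lj] := leqP j l.
    by apply: falling_basis_active; [lia|right; apply: (knots_homo _ n hx); lia].
  rewrite root_basis_poly; [|lia..].
  by apply: falling_basis_inactive; [lia|apply: (knots_homo_le _ n hx); lia].
by apply: (knots_homo_le _ n hx); lia.
Qed.

(** Peeling off top coefficients: the basis polynomial of index [m + 1] is a
    scalar multiple of a monic polynomial of degree [m]. *)
Lemma newton_expansion {R : realType} (x : nat -> R) (k m : nat) (p : {poly R}) :
  (m <= k.+1)%N -> (size p <= m)%N -> exists c, p = basis_piece x k c m.
Proof.
elim: m p => [|m IH] p mk sp.
  exists (fun=> 0); rewrite /basis_piece big_geq //.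
  by apply/eqP; rewrite -size_poly_leq0.
pose N : {poly R} := \prod_(y <- knots x 1 m.+1) ('X - y%:P).
have NE : N = m`!%:R *: basis_poly x k m.+1.
  rewrite /basis_poly /= (minn_idPl _) ?scalerA ?mulfV; [|by rewrite pnatr_eq0 -lt0n fact_gt0|by lia].
  by rewrite scale1r; congr (\prod_(y <- knots _ _ _) _); lia.
have sN : size N = m.+1 by rewrite size_prod_XsubC size_map size_iota subn1.
have [|c pc] := IH (p - p`_m *: N) (ltnW mk).
  by apply: size_sub_lead => //; exact: monic_prod_XsubC.
exists (fun j => if j == m.+1 then p`_m * m`!%:R else c j).
rewrite /basis_piece big_nat_recr //= eqxx -scalerA -NE.
rewrite -[LHS](subrK (p`_m *: N)) pc; congr (_ + _).
by apply: eq_big_nat => j hj; rewrite ltn_eqF //; lia.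
Qed.

(** Consecutive pieces which agree at the [k] points up to their common knot
    differ by a multiple of the next basis polynomial, so one coefficient per
    knot is added to the Newton coefficients of the first piece. *)
Lemma basis_piece_expansion {R : realType} (x : nat -> R) (k n : nat)
    (P : nat -> {poly R}) :
  (forall i : nat, (1 <= i)%N -> (i < n)%N -> x i < x i.+1) ->
  (forall i, (k <= i < n)%N -> (size (P i) <= k.+1)%N) ->
  (forall i, (k < i < n)%N ->
     {in knots x (i.+1 - k) i.+1, forall y, (P i).[y] = (P i.-1).[y]}) ->
  (k < n)%N ->
  exists c, forall i, (k <= i < n)%N -> P i = basis_piece x k c i.+1.
Proof.
move=> hx sP glue kn.
have [c0 Pk] : exists c, P k = basis_piece x k c k.+1.
  by apply: newton_expansion; rewrite // sP // leqnn.
pose c j := if (j <= k.+1)%N then c0 j else k`!%:R * (P j.-1 - P j.-2)`_k.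
exists c => i /andP[ki]; rewrite -(subnKC ki); move: (i - k)%N => d {i ki}.
elim: d => [_|d IH]; first rewrite addn0 Pk.
  by apply: eq_big_nat => j hj; rewrite /c ifT //; lia.
rewrite addnS => hd; rewrite /basis_piece big_nat_recr // -/(basis_piece _ _ _ _).
rewrite -IH; last by lia.
have -> : c (k + d).+2 = k`!%:R * (P (k + d).+1 - P (k + d)%N)`_k.
  by rewrite /c ifF //; lia.
set s := knots x ((k + d).+2 - k) (k + d).+2.
have ss : size s = k by rewrite size_map size_iota; lia.
rewrite /= -[LHS](subrK (P (k + d)%N)) addrC; congr (_ + _).
have -> : basis_poly x k (k + d).+2 = (k`!%:R)^-1 *: \prod_(y <- s) ('X - y%:P).
  rewrite /basis_poly /s (minn_idPr _); last by lia.
  by rewrite (maxn_idPr _) //; lia.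
rewrite scalerA mulrAC mulfV ?mul1r; last by rewrite pnatr_eq0 -lt0n fact_gt0.
rewrite -[X in _`_X]ss; apply: vanish_prodE.
- by apply: (knots_uniq _ n) => //; lia.
- rewrite ss (leq_trans (size_polyD _ _)) // geq_max size_polyN.
  by apply/andP; split; apply: sP; lia.
- move=> y ys; rewrite hornerD hornerN (glue (k + d).+1) ?subrr //; lia.
Qed.

(** * Matching derivatives *)

Lemma discrete_deriv_interp {R : realType} (x : nat -> R) (n k i : nat)
    (f : R -> R) (t : R) (p : {poly R}) :
  (forall i : nat, (1 <= i)%N -> (i < n)%N -> x i < x i.+1) ->
  (0 < k <= i)%N -> (i <= n)%N -> x i < t <= x i.+1 ->
  (size p <= k.+1)%N -> f t = p.[t] ->
  {in knots x (i.+1 - k) i.+1, forall y, p.[y] = f y} ->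
  discrete_deriv n x k f t = k`!%:R * p`_k.
Proof.
move=> hx hk hin hit sp ft fp; rewrite (discrete_derivE x n k i f t) //.
have ss : size (rcons (knots x (i.+1 - k) i.+1) t) = k.+1.
  by rewrite size_rcons size_map size_iota; lia.
rewrite (divdiff_interp _ _ p) ?ss //.
- rewrite rcons_uniq (knots_uniq _ n) ?andbT //; [|lia..].
  apply/mapP => -[l]; rewrite mem_index_iota => hl e.
  have : x l <= x i by apply: (knots_homo_le _ n hx); lia.
  by rewrite -e leNgt; case/andP: hit => ->.
- by rewrite -size_eq0 ss.
- by move=> y; rewrite mem_rcons inE => /predU1P[->//|/fp].
Qed.

(** Everything follows from a local description: each point lies in some
    (x_i, x_{i+1}] on which [f] is a polynomial of degree at most [k] that still
    agrees with [f] at the [k] design points up to [x_i]. *)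
Lemma falling_span_matching {R : realType} {k n : nat} {a b : R} {x : nat -> R}
    {f : R -> R} :
  (forall i : nat, (1 <= i)%N -> (i < n)%N -> x i < x i.+1) ->
  (k < n)%N -> a <= x 1%N -> x n <= b -> x n.+1 = b ->
  in_falling_span a b n x k f ->
  has_lderivative_n a b x k f /\ matching_derivatives a b n x k f.
Proof.
move=> hx kn ax xb xnb [c fc].
have [->|k0] := posnP k; first by split.
have x_le_b i : (i <= n)%N -> (0 < i)%N -> x i.+1 <= b.
  move=> hin i0; have [->|ne] := eqVneq i n; first by rewrite xnb.
  by apply: le_trans xb; apply: (knots_homo_le _ n hx); lia.
have a_le_x i : (0 < i <= n)%N -> a <= x i.
  by move=> hi; apply: (le_trans ax); apply: (knots_homo_le _ n hx); lia.
suff local t : t \in match_range a b x k -> exists (i : nat) (p : {poly R}),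
    [/\ (k <= i <= n)%N, x i < t <= x i.+1, (size p <= k.+1)%N,
        {in `]x i, x i.+1], f =1 horner p} &
        {in knots x (i.+1 - k) i.+1, forall y, p.[y] = f y}].
  split=> [m mk t /local|t /local] [i [p [hi hit sp fp pk]]].
    apply: (@cvgP _ _ (p^`(m.+1)).[t]); rewrite derivnS.
    have it : x i < t by case/andP: hit.
    apply: (left_quotient_poly _ _ _ _ it) => w hw.
    apply: (lderivative_n_poly _ _ _ _ m fp); move: hw.
    rewrite !in_itv /= => /andP[-> wt] /=.
    by apply: (le_trans wt); case/andP: hit.
  rewrite (lderivative_n_top _ _ _ _ _ sp fp) ?in_itv //.
  apply: (discrete_deriv_interp x n k i) => //; [lia|lia|].
  by apply: fp; rewrite in_itv.
rewrite /match_range eqn0Ngt k0 /= in_itv /= -xnb => /ex_knot_itv[|i [hi hit]].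
  by lia.
exists i, (basis_piece x k c (minn i.+1 n)); split => //.
- exact: size_basis_piece.
- move=> w; rewrite in_itv /= => /andP[iw wi].
  rewrite fc; last first.
    rewrite in_itv /=; apply/andP; split.
      by apply: le_trans (ltW iw); apply: a_le_x; lia.
    by apply: (le_trans wi); apply: x_le_b; lia.
  by apply: (falling_sum_itv _ _ _ _ _ _ hx) => //; lia.
- move=> _ /mapP[l + ->]; rewrite mem_index_iota => hl.
  rewrite fc; last first.
    rewrite in_itv /= a_le_x ?(le_trans _ xb) //; last by lia.
    by apply: (knots_homo_le _ n hx); lia.
  by apply/esym/(falling_sum_knot _ _ _ _ _ _ hx) => //; lia.
Qed.

Lemma falling_basis_in_span {R : realType} (a b : R) (n : nat) (x : nat -> R) (k j : nat) :
  (1 <= j <= n)%N -> in_falling_span a b n x k (falling_basis x k j).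
Proof.
move=> hj; exists (fun i => (i == j)%:R) => t _.
have jn : j \in index_iota 1 n.+1 by rewrite mem_index_iota.
rewrite (bigD1_seq j) ?iota_uniq //= eqxx mul1r big1 ?addr0 // => i /negPf->.
by rewrite mul0r.
Qed.

(** Matching on (x_i, x_{i+1}], for [k < i < n], forces the piece [P i] to agree
    with [f] at the [k] points up to [x_i].  The first piece does so because
    these points belong to its own segment. *)
Lemma matching_in_falling_span {R : realType} {k n : nat} {a b : R} {x : nat -> R}
    {f : R -> R} :
  (forall i : nat, (1 <= i)%N -> (i < n)%N -> x i < x i.+1) ->
  (k < n)%N -> a <= x 1%N -> x n <= b ->
  piecewise_poly a b n x k f -> matching_derivatives a b n x k f ->
  in_falling_span a b n x k f.
Proof.
move=> hx kn ax xb pw match_f.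
have [P hP] : {P : nat -> {poly R} | forall i, (k <= i < n)%N ->
    (size (P i) <= k.+1)%N /\ {in segment a b n x k i, forall t, f t = (P i).[t]}}.
  have /choice[P hP] : forall i, exists p : {poly R}, (k <= i < n)%N ->
      (size p <= k.+1)%N /\ {in segment a b n x k i, forall t, f t = p.[t]}.
    move=> i; case hi : (k <= i < n)%N; last by exists 0.
    by have [p hp] := pw i hi; exists p.
  by exists P.
have sP i : (k <= i < n)%N -> (size (P i) <= k.+1)%N by case/hP.
have x_le_b i : (0 < i <= n)%N -> x i <= b.
  by move=> hi; apply: le_trans xb; apply: (knots_homo_le _ n hx); lia.
have fP_last i t : (k <= i < n)%N -> (if i == k then a <= t else x i < t) ->
    t <= b -> ((i.+1 < n)%N -> t <= x i.+1) -> f t = (P i).[t].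
  move=> hi; case: (hP i hi) => _ fPi it tb ti; apply: fPi.
  rewrite /segment; case: ifP it => _ it; rewrite in_itv /= it /=;
  by case: ifP => // /negbT ne; apply: ti; lia.
have fP i t : (k <= i < n)%N -> (if i == k then a <= t else x i < t) ->
    t <= x i.+1 -> f t = (P i).[t].
  move=> hi it ti; apply: fP_last => //.
  by apply: (le_trans ti); apply: x_le_b; lia.
have P_knots i : (k <= i < n)%N ->
    {in knots x (i.+1 - k) i.+1, forall y, (P i).[y] = f y}.
  move=> hi; have ss : size (knots x (i.+1 - k) i.+1) = k.
    by rewrite size_map size_iota; lia.
  have [ik|ne_ik] := eqVneq i k.
    move=> _ /mapP[l + ->]; rewrite mem_index_iota => hl; apply/esym/fP => //.
      rewrite ik eqxx; apply: (le_trans ax).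
      by apply: (knots_homo_le _ n hx); lia.
    by apply: (knots_homo_le _ n hx); lia.
  (* No divided difference is available when [k = 0], but the window is empty. *)
  have [k0|k0] := posnP k.
    by move=> y; rewrite (size0nil (etrans ss k0)).
  have fPi : {in `]x i, x i.+1], f =1 horner (P i)}.
    move=> t; rewrite in_itv /= => /andP[it ti].
    by apply: fP => //; rewrite (negPf ne_ik).
  apply: (divdiff_const_interp f _ (P i) (x i) (x i.+1)) => //.
  - by apply: hx; lia.
  - by apply: (knots_uniq _ n) => //; lia.
  - move=> _ /mapP[l + ->]; rewrite mem_index_iota => hl.
    by apply: (knots_homo_le _ n hx); lia.
  move=> t tP; have it : x i < t <= x i.+1 by rewrite in_itv in tP.
  have k1 : k`!%:R != 0 :> R by rewrite pnatr_eq0 -lt0n fact_gt0.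
  apply: (mulfI k1); rewrite ss -(discrete_derivE x n k i) //; [|lia..].
  rewrite match_f; last first.
    rewrite /match_range eqn0Ngt k0 /= in_itv /=; case/andP: it => it ti.
    rewrite (le_trans ti) ?x_le_b ?andbT //; last by lia.
    by apply: le_lt_trans it; apply: (knots_homo_le _ n hx); lia.
  by apply: (lderivative_n_top f (P i) (x i) (x i.+1)) => //; exact: sP.
have [c Pc] : exists c, forall i, (k <= i < n)%N -> P i = basis_piece x k c i.+1.
  apply: (basis_piece_expansion x k n P hx sP) => // -[//|i] hi y yi.
  rewrite P_knots //; last by lia.
  move: yi => /mapP[l + ->]; rewrite mem_index_iota => hl.
  (* The common knot lies in the segment of the left piece; the other points of
     the window belong to the window of the left piece. *)
  have [->|ne_li] := eqVneq l i.+1.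
    apply: fP => //=; first by lia.
    case: ifP => _; last by apply: hx; lia.
    by apply: (le_trans ax); apply: (knots_homo_le _ n hx); lia.
  apply/esym/P_knots; first by lia.
  by apply: map_f; rewrite mem_index_iota; lia.
exists c => t; rewrite in_itv /= => /andP[at_ tb].
(* The last segment extends to [b], beyond [x n], hence the guarded bound. *)
have [i [hi it ti]] : exists i, [/\ (k <= i < n)%N,
    if i == k then a <= t else x i < t & (i.+1 < n)%N -> t <= x i.+1].
  have [nk|nk] := eqVneq n k.+1; first by exists k; rewrite eqxx; split=> //; lia.
  have [tk|kt] := leP t (x k.+1).
    by exists k; rewrite eqxx leqnn.
  have [tn|nt] := leP t (x n.-1).
    have kn1 : (k.+1 <= n.-1)%N by lia.
    have [|i [hi /andP[it ti]]] := ex_knot_itv x k.+1 n.-1 t _ kn1.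
      by rewrite kt.
    by exists i; split; [lia|rewrite ifF //; lia|].
  exists n.-1; split; [lia| |lia].
  by case: ifP.
have mi : minn i.+1 n = i.+1 by lia.
rewrite (fP_last i t) // Pc // -mi; apply/esym/(falling_sum_itv _ _ _ _ _ _ hx) => //.
  by lia.
by move=> ki; move: it; rewrite gtn_eqF.
Qed.

Theorem corollary1 (R : realType) (k n : nat) (a b : R) (x : nat -> R)
  (hn : (k.+1 <= n)%N)
  (hax : a <= x 1%N)
  (hx : forall i : nat, (1 <= i)%N -> (i < n)%N -> x i < x i.+1)
  (hxb : x n <= b)
  (hxn1 : x n.+1 = b) :
  (forall j : nat, (1 <= j <= n)%N ->
     has_lderivative_n a b x k (falling_basis x k j) /\
     matching_derivatives a b n x k (falling_basis x k j)) /\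
  (forall f : R -> R, in_falling_span a b n x k f ->
     has_lderivative_n a b x k f /\ matching_derivatives a b n x k f) /\
  (forall f : R -> R, piecewise_poly a b n x k f ->
     matching_derivatives a b n x k f -> in_falling_span a b n x k f).
Proof.
split=> [j hj|].
  exact: (falling_span_matching hx hn hax hxb hxn1 (falling_basis_in_span _ _ _ _ _ _ hj)).
split=> f; first exact: falling_span_matching.
exact: matching_in_falling_span.
Qed.
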